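(* Let $K=\mathbb{R}^m_+$ and let $\overline{A}=[\overline a_1\mid\dots\mid\overline a_m]^T\in\mathbb{R}^{m\times n}$, $\overline b\in\mathbb{R}^m$ be such that $\{x\in\mathbb{R}^n:\overline Ax+\overline b\in -\mathbb{R}^m_+\}\neq\emptyset$. Let $\mathcal B=\{\lambda\in\mathbb{R}^m_+:\sum_{i=1}^m\lambda_i=1\}$. Then the radius of robust feasibility satisfies $$\rho(\overline A,\overline b)=\mathrm{dist}\big(0_{n+1},E(\overline A,\overline b,\mathcal B)\big)=f^\ast_{LP},$$ where $f^\ast_{LP}$ is the optimal value of the second-order cone program $$\inf_{(z,s,t,\lambda)\in\mathbb{R}^n\times\mathbb{R}\times\mathbb{R}\times\mathbb{R}^m}\Big\{t:\ \|(z,s)\|\le t,\ z=\overline A^T\lambda,\ s\ge-\overline b^T\lambda,\ \lambda\in\mathbb{R}^m_+,\ \sum_{i=1}^m\lambda_i=1\Big\}.$$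
   Context: $\|\cdot\|$ is the Euclidean norm, $\mathbb{B}_{n+1}$ the closed Euclidean unit ball of $\mathbb{R}^{n+1}$, $\mathrm{dist}(x,X)=\inf_{y\in X}\|x-y\|$. For $r\in\mathbb{R}^m_+$, the robust feasible set is $$F_r(\overline A,\overline b)=\{x\in\mathbb{R}^n: (a_1^Tx+b_1,\dots,a_m^Tx+b_m)^T\in -K\ \ \forall (a_i,b_i)\in(\overline a_i,\overline b_i)+r_i\mathbb{B}_{n+1},\ i=1,\dots,m\}.$$ The admissible set is $C(\overline A,\overline b)=\{r\in\mathbb{R}^m_+:F_r(\overline A,\overline b)\ne\emptyset\}$, and the radius of robust feasibility is $\rho(\overline A,\overline b)=\sup\{\alpha\in\mathbb{R}_+:\alpha 1_m\in C(\overline A,\overline b)\}$, with $1_m$ the all-ones vector. The epigraphical set is $E(\overline A,\overline b,\mathcal B)=\{(\overline A^T\lambda,\,-\overline b^T\lambda):\lambda\in\mathcal B\}+\{0_n\}\times\mathbb{R}_+\subseteq\mathbb{R}^{n+1}$. *)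

(* Defs.v *)
From HB Require Import structures.
From mathcomp Require Import all_boot all_order all_algebra.
From mathcomp Require Import all_classical all_reals ereal.

Set Implicit Arguments.
Unset Strict Implicit.
Unset Printing Implicit Defensive.

Import Order.TTheory GRing.Theory Num.Theory.

Local Open Scope classical_set_scope.
Local Open Scope ring_scope.

(* The norm that MathComp-Analysis puts on matrices is the max norm, hence
   Euclidean versions of the norm, the unit ball and the distance. *)
Definition eucl_norm (R : realType) (k : nat) (x : 'cV[R]_k) : R :=
  Num.sqrt (\sum_(i < k) x i 0 ^+ 2).

Definition eucl_unit_ball (R : realType) (k : nat) : set 'cV[R]_k :=
  [set u | eucl_norm u <= 1].

(* Extended-real valued: the distance to the empty set is +oo. *)
Definition dist_set (R : realType) (k : nat) (x : 'cV[R]_k)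
    (X : set 'cV[R]_k) : \bar R :=
  ereal_inf [set (eucl_norm (x - y))%:E | y in X].

Definition nonneg_orthant (R : realType) (m : nat) : set 'cV[R]_m :=
  [set y | forall i, 0 <= y i 0].

(* R^n x R is identified with R^(n+1) = 'cV_(n + 1) by stacking the two
   components; the i-th datum is (a_i, b_i), with a_i^T the i-th row of A. *)
Definition pair_vec (R : realType) (n : nat) (z : 'cV[R]_n) (s : R) :
    'cV[R]_(n + 1) :=
  col_mx z s%:M.

Definition datum (R : realType) (m n : nat) (A : 'M[R]_(m, n)) (b : 'cV[R]_m)
    (i : 'I_m) : 'cV[R]_(n + 1) :=
  pair_vec (row i A)^T (b i 0).

Definition nominal_feasible (R : realType) (m n : nat) (K : set 'cV[R]_m)
    (A : 'M[R]_(m, n)) (b : 'cV[R]_m) : set 'cV[R]_n :=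
  [set x | [set - y | y in K] (A *m x + b)].

Definition robust_feasible (R : realType) (m n : nat) (K : set 'cV[R]_m)
    (A : 'M[R]_(m, n)) (b : 'cV[R]_m) (r : 'cV[R]_m) : set 'cV[R]_n :=
  [set x | forall (A' : 'M[R]_(m, n)) (b' : 'cV[R]_m),
     (forall i, [set datum A b i + r i 0 *: u | u in @eucl_unit_ball R (n + 1)]
                  (datum A' b' i)) ->
     nominal_feasible K A' b' x].

Definition admissible (R : realType) (m n : nat) (K : set 'cV[R]_m)
    (A : 'M[R]_(m, n)) (b : 'cV[R]_m) : set 'cV[R]_m :=
  [set r | @nonneg_orthant R m r /\ robust_feasible K A b r !=set0].

(* The supremum is taken in the extended reals, so that nothing is assumed
   about its finiteness. *)
Definition radius_robust_feasibility (R : realType) (m n : nat)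
    (K : set 'cV[R]_m) (A : 'M[R]_(m, n)) (b : 'cV[R]_m) : \bar R :=
  ereal_sup [set alpha%:E | alpha in
    [set alpha : R | 0 <= alpha /\ admissible K A b (const_mx alpha)]].

Definition std_simplex (R : realType) (m : nat) : set 'cV[R]_m :=
  [set lam | @nonneg_orthant R m lam /\ \sum_(i < m) lam i 0 = 1].

Definition epigraphical_set (R : realType) (m n : nat) (A : 'M[R]_(m, n))
    (b : 'cV[R]_m) (B : set 'cV[R]_m) : set 'cV[R]_(n + 1) :=
  [set p + q | p in [set pair_vec (A^T *m lam) (- (b^T *m lam) 0 0) | lam in B]
             & q in [set pair_vec 0 c | c in [set c : R | 0 <= c]]].

Definition socp_feasible (R : realType) (m n : nat) (A : 'M[R]_(m, n))
    (b : 'cV[R]_m) (z : 'cV[R]_n) (s t : R) (lam : 'cV[R]_m) : Prop :=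
  [/\ eucl_norm (pair_vec z s) <= t,
      z = A^T *m lam,
      - (b^T *m lam) 0 0 <= s,
      @nonneg_orthant R m lam &
      \sum_(i < m) lam i 0 = 1].

Definition socp_value (R : realType) (m n : nat) (A : 'M[R]_(m, n))
    (b : 'cV[R]_m) : \bar R :=
  ereal_inf [set v | exists (z : 'cV[R]_n) (s t : R) (lam : 'cV[R]_m),
                       socp_feasible A b z s t lam /\ v = t%:E].

(* Main.v *)
(* A point x is robust feasible for radius alpha iff
   a_i^T x + b_i + alpha ||(x, 1)|| <= 0 for all i. Averaging these inequalities
   with weights lam and applying Cauchy-Schwarz to <(z, s), (-x, 1)> gives
   alpha <= ||(z, s)|| on the epigraphical set E. Conversely, let d = dist(0, E)
   and let (z, s) in E, with s >= 0, be nearly of minimal norm, so that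
   <(z, s), (a_i, -b_i)> is at least d^2 up to a small error. Mixing the
   candidate -z / s with a nominally feasible x0 into
   x = (tau x0 - z) / (s + tau) covers the case s = 0, and x is robust feasible
   for every given alpha < d once tau is small. Working with near-minimisers
   avoids any compactness argument. *)
Require Import Defs.
From HB Require Import structures.
From mathcomp Require Import all_boot all_order all_algebra.
From mathcomp Require Import all_classical all_reals ereal.
From mathcomp Require Import ring lra.

Import Order.TTheory GRing.Theory Num.Theory.

Local Open Scope classical_set_scope.
Local Open Scope ring_scope.

Definition dotv {R : realType} {k : nat} (u v : 'cV[R]_k) : R :=
  (u^T *m v) 0 0.

(** * Inner product and Euclidean norm on column vectors *)

Section EuclideanSpace.
Context {R : realType} {k : nat}.
Implicit Types (u v w : 'cV[R]_k) (c : R).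

Lemma dotvE u v : dotv u v = \sum_i u i 0 * v i 0.
Proof. by rewrite /dotv mxE; apply: eq_bigr => i _; rewrite mxE. Qed.

Lemma dotvC u v : dotv u v = dotv v u.
Proof. by rewrite !dotvE; apply: eq_bigr => i _; rewrite mulrC. Qed.

Lemma dotvDr u v w : dotv u (v + w) = dotv u v + dotv u w.
Proof. by rewrite /dotv mulmxDr mxE. Qed.

Lemma dotvZr c u v : dotv u (c *: v) = c * dotv u v.
Proof. by rewrite /dotv -scalemxAr mxE. Qed.

Lemma dotvDl u v w : dotv (u + v) w = dotv u w + dotv v w.
Proof. by rewrite dotvC dotvDr !(dotvC w). Qed.

Lemma dotvZl c u v : dotv (c *: u) v = c * dotv u v.
Proof. by rewrite dotvC dotvZr dotvC. Qed.

Lemma dotvNr u v : dotv u (- v) = - dotv u v.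
Proof. by rewrite -scaleN1r dotvZr mulN1r. Qed.

Lemma dotvNl u v : dotv (- u) v = - dotv u v.
Proof. by rewrite dotvC dotvNr dotvC. Qed.

Lemma dotvv_ge0 u : 0 <= dotv u u.
Proof. by rewrite dotvE sumr_ge0 // => i _; rewrite -expr2 sqr_ge0. Qed.

Lemma eucl_normE u : eucl_norm u = Num.sqrt (dotv u u).
Proof.
by rewrite /eucl_norm dotvE; congr Num.sqrt; apply: eq_bigr => i _; rewrite expr2.
Qed.

Lemma eucl_norm_ge0 u : 0 <= eucl_norm u.
Proof. exact: sqrtr_ge0. Qed.

Lemma sqr_eucl_norm u : eucl_norm u ^+ 2 = dotv u u.
Proof. by rewrite eucl_normE sqr_sqrtr// dotvv_ge0. Qed.

Lemma ler_eucl_norm u v : dotv u u <= dotv v v -> eucl_norm u <= eucl_norm v.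
Proof. by rewrite !eucl_normE => /ler_wsqrtr. Qed.

Lemma eucl_normN u : eucl_norm (- u) = eucl_norm u.
Proof. by rewrite !eucl_normE dotvNl dotvNr opprK. Qed.

Lemma eucl_normZ c u : 0 <= c -> eucl_norm (c *: u) = c * eucl_norm u.
Proof.
move=> c0; rewrite !eucl_normE dotvZl dotvZr mulrA -expr2 sqrtrM ?sqr_ge0//.
by rewrite sqrtr_sqr ger0_norm.
Qed.

(** With [a], [b] the norms of [u], [v], expand the squared length of [b *: u - a *: v], which is
    nonnegative, and cancel [a * b]; zero norms are treated apart. *)
Lemma CauchySchwarz u v : dotv u v <= eucl_norm u * eucl_norm v.
Proof.
have nu := eucl_norm_ge0 u; have nv := eucl_norm_ge0 v.
have su := sqr_eucl_norm u; have sv := sqr_eucl_norm v.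
set a := eucl_norm u in nu su *; set b := eucl_norm v in nv sv *.
have sq (x : R) w : x = 0 -> x ^+ 2 = dotv w w -> w = 0.
  move=> -> /esym; rewrite expr0n/= dotvE => /eqP.
  rewrite psumr_eq0; last by move=> i _; rewrite -expr2 sqr_ge0.
  move=> /allP w0; apply/matrixP => i j; rewrite ord1 mxE.
  by have := w0 i (mem_index_enum _); rewrite /= mulf_eq0 orbb => /eqP.
have [a0|a0] := eqVneq a 0.
  rewrite (sq _ _ a0 su) -(scale0r 0) dotvZl mul0r; exact: mulr_ge0.
have [b0|b0] := eqVneq b 0.
  rewrite (sq _ _ b0 sv) -(scale0r 0) dotvZr mul0r; exact: mulr_ge0.
have := dotvv_ge0 (b *: u - a *: v).
rewrite !(dotvDl, dotvDr, dotvNl, dotvNr, dotvZl, dotvZr) (dotvC v u) -su -sv.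
have ab : 0 < a * b by rewrite lt0r mulf_neq0 ?mulr_ge0.
move=> h; rewrite -(ler_pM2l ab); lra.
Qed.

Lemma ler_eucl_normD u v : eucl_norm (u + v) <= eucl_norm u + eucl_norm v.
Proof.
have h : 0 <= eucl_norm u + eucl_norm v by rewrite addr_ge0 ?eucl_norm_ge0.
rewrite -(ler_pXn2r (ltn0Sn 1)) ?nnegrE ?eucl_norm_ge0//.
rewrite sqr_eucl_norm sqrrD !sqr_eucl_norm dotvDl !dotvDr (dotvC v u).
have := CauchySchwarz u v; lra.
Qed.

(* A point [w] of a convex set that nearly minimises the norm satisfies the
   variational inequality of the projection up to an error [tau]: moving from
   [w] towards [e] by a step [tau] cannot decrease the norm much. *)
Lemma near_projection (d tau D : R) w e :
  0 <= d -> 0 < tau <= 1 ->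
  d <= eucl_norm ((1 - tau) *: w + tau *: e) ->
  eucl_norm w <= d + tau ^+ 2 ->
  eucl_norm e <= D ->
  eucl_norm w ^+ 2 - tau * (d + 1 + (D + (d + 1)) ^+ 2) <= dotv w e.
Proof.
move=> d0 /andP[t0 t1] hd hw he.
have nw := eucl_norm_ge0 w; have ne := eucl_norm_ge0 e.
have t21 : tau ^+ 2 <= 1 by rewrite expr_le1// ltW.
have hew : dotv (e - w) (e - w) <= (D + (d + 1)) ^+ 2.
  rewrite -sqr_eucl_norm ler_sqr ?nnegrE ?eucl_norm_ge0//; last lra.
  by apply: (le_trans (ler_eucl_normD _ _)); rewrite eucl_normN; lra.
have hw2 : dotv w w <= (d + tau ^+ 2) ^+ 2.
  by rewrite -sqr_eucl_norm ler_sqr ?nnegrE//; lra.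
have : d ^+ 2 <= dotv ((1 - tau) *: w + tau *: e) ((1 - tau) *: w + tau *: e).
  by rewrite -sqr_eucl_norm ler_sqr ?nnegrE ?eucl_norm_ge0.
rewrite !(dotvDl, dotvDr, dotvNl, dotvNr, dotvZl, dotvZr, sqr_eucl_norm) in hew hw2 *.
rewrite (dotvC e w) in hew *.
set W := dotv w w in hew hw2 *; set P := dotv w e in hew *.
set E := dotv e e in hew *; set M := (D + _) ^+ 2 in hew *.
move=> h.
(* Here [W - 2 * P + E] is the squared length of [e - w], the coefficient of [tau ^+ 2] in the
   expansion of the moved point. *)
have hM : tau ^+ 2 * (E - P - (P - W)) <= tau ^+ 2 * M.
  by rewrite ler_wpM2l ?sqr_ge0//; lra.
have h4 : tau ^+ 2 * tau ^+ 2 <= tau ^+ 2 by rewrite ler_piMr ?sqr_ge0.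
have M0 : 0 <= tau * M by rewrite mulr_ge0 ?sqr_ge0// ltW.
have M1 : 0 <= tau * (d + 1) by rewrite mulr_ge0//; lra.
(* The slack [tau ^+ 2] allowed on the norm of [w] has the order of the quadratic term, so an error
   of order [tau] remains once [tau] is cancelled. *)
have : tau * (W - P) <= tau * (tau * ((d + 1) + M)).
  have : 0 <= tau ^+ 2 * M by rewrite mulr_ge0 ?sqr_ge0.
  have := sqr_ge0 tau; lra.
rewrite ler_pM2l//; lra.
Qed.

End EuclideanSpace.

(** * Robust constraints as norm inequalities *)

Section RobustFeasibility.
Context {R : realType} {m n : nat}.
Implicit Types (A : 'M[R]_(m, n)) (b : 'cV[R]_m) (x z : 'cV[R]_n) (lam : 'cV[R]_m) (s t : R).

Lemma dotv_pair (p : nat) (z x : 'cV[R]_p) s t :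
  dotv (pair_vec z s) (pair_vec x t) = dotv z x + s * t.
Proof.
rewrite /dotv /pair_vec tr_col_mx mul_row_col mxE tr_scalar_mx -scalar_mxM.
by rewrite [s * t]lock !mxE -lock mulr1n.
Qed.

Lemma pair_vecD z x s t : pair_vec z s + pair_vec x t = pair_vec (z + x) (s + t).
Proof. by rewrite /pair_vec add_col_mx raddfD. Qed.

Lemma pair_vecZ c z s : c *: pair_vec z s = pair_vec (c *: z) (c * s).
Proof. by rewrite /pair_vec scale_col_mx scale_scalar_mx. Qed.

Lemma dotv_datum A b i x t : dotv (datum A b i) (pair_vec x t)
  = (A *m x) i 0 + b i 0 * t.
Proof. by rewrite dotv_pair /dotv trmxK -row_mul mxE. Qed.

Lemma nominal_feasibleP A b x : nominal_feasible (@nonneg_orthant R m) A b x <->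
  forall i, (A *m x + b) i 0 <= 0.
Proof.
split=> [[y y0 yE] i|h]; first by rewrite -yE mxE oppr_le0.
by exists (- (A *m x + b)); rewrite ?opprK// => i; rewrite mxE oppr_ge0.
Qed.

Context (A : 'M[R]_(m, n)) (b : 'cV[R]_m).

(** Each constraint is linear in its datum, so over a ball of radius [r i 0] its worst case is
    reached in the direction of [(x, 1)]; Cauchy-Schwarz shows that no other perturbation does
    worse. *)
Lemma robust_feasibleP (r : 'cV[R]_m) x : nonneg_orthant r ->
  robust_feasible (@nonneg_orthant R m) A b r x <->
  forall i, (A *m x + b) i 0 + r i 0 * eucl_norm (pair_vec x 1) <= 0.
Proof.
move=> r0; set N := eucl_norm _.
have N2 : N ^+ 2 = dotv x x + 1 by rewrite sqr_eucl_norm dotv_pair mulr1.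
have N0 : 0 < N.
  rewrite lt0r eucl_norm_ge0 andbT; apply/eqP => N0.
  by move: N2 (dotvv_ge0 x); rewrite N0 expr0n/=; lra.
split=> [h i|h A' b' h'].
  pose u : 'cV[R]_(n + 1) := N^-1 *: pair_vec x 1.
  (* The worst direction is the same for all rows, so one rank-one update of [A] attains every worst
     case at once. *)
  have feas : nominal_feasible (@nonneg_orthant R m)
      (A + r *m (N^-1 *: x)^T) (b + N^-1 *: r) x.
    apply: h => j; exists u.
      by rewrite /eucl_unit_ball/= eucl_normZ -/N ?mulVf ?gt_eqF ?invr_ge0 ?(ltW N0).
    rewrite /u /datum !pair_vecZ pair_vecD.
    congr pair_vec; last by rewrite !mxE mulr1 mulrC.
    by apply/matrixP => p q; rewrite !mxE big_ord1 !mxE ord1.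
  have := (nominal_feasibleP _ _ _).1 feas i.
  rewrite mulmxDl -mulmxA linearZ/= -scalemxAl -scalemxAr.
  rewrite [x^T *m x]mx11_scalar -/(dotv x x).
  rewrite [r *m _]mul_mx_scalar !mxE.
  have NE : N^-1 * (dotv x x + 1) = N by rewrite -N2 expr2 mulKf ?gt_eqF.
  rewrite -[X in r i 0 * X]NE; lra.
apply/nominal_feasibleP => i.
have [u u1 uE] := h' i.
rewrite mxE -[b' i 0]mulr1 -dotv_datum -uE dotvDl dotvZl dotv_datum mulr1.
apply: le_trans (h i); rewrite !mxE lerD2l ler_wpM2l//.
apply: (le_trans (CauchySchwarz _ _)); rewrite ler_piMl//.
exact: eucl_norm_ge0.
Qed.

(** * The epigraphical set over the simplex *)

Lemma epigraphicalP (e : 'cV[R]_(n + 1)) :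
  epigraphical_set A b (@std_simplex R m) e <->
  exists lam s, [/\ std_simplex lam, - dotv b lam <= s &
    e = pair_vec (A^T *m lam) s].
Proof.
split=> [[_ [lam lamS <-]] [_ [c c0 <-]] <-|[lam [s [lamS hs ->]]]].
  exists lam, (- dotv b lam + c); split=> //; first by rewrite lerDl.
  by rewrite pair_vecD addr0.
exists (pair_vec (A^T *m lam) (- dotv b lam)); first by exists lam.
exists (pair_vec 0 (s + dotv b lam)).
  by exists (s + dotv b lam) => //=; rewrite -lerBlDr sub0r.
by rewrite pair_vecD addr0 addrC addrK.
Qed.

Lemma epigraphical_convex (tau : R) (e f : 'cV[R]_(n + 1)) : 0 <= tau <= 1 ->
  epigraphical_set A b (@std_simplex R m) e ->
  epigraphical_set A b (@std_simplex R m) f ->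
  epigraphical_set A b (@std_simplex R m) ((1 - tau) *: e + tau *: f).
Proof.
move=> /andP[t0 t1] /epigraphicalP[l [s [[l0 l1] hs ->]]].
move=> /epigraphicalP[l' [s' [[l'0 l'1] hs' ->]]].
have t1' : 0 <= 1 - tau by rewrite subr_ge0.
apply/epigraphicalP; exists ((1 - tau) *: l + tau *: l').
exists ((1 - tau) * s + tau * s'); split.
- split=> [i|]; first by rewrite !mxE addr_ge0// mulr_ge0.
  under eq_bigr do rewrite !mxE.
  by rewrite big_split/= -!mulr_sumr l1 l'1 !mulr1 subrK.
- rewrite dotvDr !dotvZr opprD -!mulrN.
  by rewrite lerD// ler_wpM2l.
- by rewrite !pair_vecZ pair_vecD mulmxDr -!scalemxAr.
Qed.

(** These points come from the vertices of the simplex; the sign of [b] is flipped because the last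
    coordinate of the set is bounded below by [- dotv b lam]. *)
Lemma epigraphical_vertex i :
  epigraphical_set A b (@std_simplex R m) (datum A (- b) i).
Proof.
apply/epigraphicalP; exists (delta_mx i 0), (- b i 0); split.
- split=> [j|]; first by rewrite mxE eqxx andbT ler0n.
  rewrite (bigD1 i)//= mxE !eqxx big1 ?addr0// => j /negPf ji.
  by rewrite mxE ji.
- by rewrite /dotv -colE !mxE.
- by rewrite /datum -colE tr_row mxE.
Qed.

(** * Admissible levels against norms on the epigraphical set *)

Lemma radius_le_norm alpha x (e : 'cV[R]_(n + 1)) :
  (forall i, (A *m x + b) i 0 + alpha * eucl_norm (pair_vec x 1) <= 0) ->
  epigraphical_set A b (@std_simplex R m) e -> alpha <= eucl_norm e.
Proof.
move=> h /epigraphicalP[l [s [[l0 l1] hs ->]]].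
have nx : eucl_norm (pair_vec (- x) 1) = eucl_norm (pair_vec x 1).
  by rewrite !eucl_normE !dotv_pair dotvNl dotvNr opprK.
have n0 : 0 < eucl_norm (pair_vec x 1).
  rewrite eucl_normE sqrtr_gt0 dotv_pair mulr1.
  by rewrite ltr_wpDl ?dotvv_ge0 ?ltr01.
rewrite -(ler_pM2r n0) -{2}nx.
apply: le_trans (CauchySchwarz _ _).
rewrite dotv_pair mulr1 dotvNr.
have -> : dotv (A^T *m l) x = dotv l (A *m x).
  by rewrite /dotv trmx_mul trmxK mulmxA.
have : dotv l (A *m x + b) + alpha * eucl_norm (pair_vec x 1) <= 0.
  (* The weights sum to 1, so the constant term is also a weighted sum and merges with the first one
     into a sum of nonpositive terms. *)
  rewrite -[X in _ + X]mul1r -[X in X * (_ * _)]l1 dotvE mulr_suml -big_split/=.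
  by rewrite sumr_le0// => i _; rewrite -mulrDr mulr_ge0_le0.
rewrite dotvDr (dotvC l b); lra.
Qed.

(** The last two hypotheses say that [d] is the infimum of the norm on the set. Only levels strictly
    below [d] are treated: the gap [d ^+ 2 - alpha * d] absorbs all errors. *)
Lemma admissible_lt_dist (alpha d : R) x0 :
  (forall i, (A *m x0 + b) i 0 <= 0) -> 0 <= alpha < d ->
  (forall e, epigraphical_set A b (@std_simplex R m) e -> d <= eucl_norm e) ->
  (forall eps, 0 < eps -> exists2 e,
    epigraphical_set A b (@std_simplex R m) e & eucl_norm e < d + eps) ->
  exists x, forall i, (A *m x + b) i 0 + alpha * eucl_norm (pair_vec x 1) <= 0.
Proof.
move=> hx0 /andP[a0 ad] dE infE.
have d0 : 0 < d by exact: le_lt_trans ad.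
pose C := eucl_norm (pair_vec x0 1); have C0 : 0 <= C := eucl_norm_ge0 _.
pose D := \sum_i eucl_norm (datum A (- b) i).
have hD i : eucl_norm (datum A (- b) i) <= D.
  by rewrite /D (bigD1 i)//= lerDl sumr_ge0// => j _; exact: eucl_norm_ge0.
(* The error constant of [near_projection], with [D] bounding the vertices uniformly in [i]. *)
pose D' := d + 1 + (D + (d + 1)) ^+ 2.
have D'0 : 0 < D' by rewrite ltr_wpDr ?sqr_ge0// addr_gt0.
have Q0 : 0 < alpha * (C + 1) + D' by rewrite ltr_wpDl// mulr_ge0// addr_ge0.
have g0 : 0 < d ^+ 2 - alpha * d by rewrite subr_gt0 expr2 ltr_pM2r.
(* The quotient makes the total error, at most [tau * (alpha * (C + 1) + D')], fit into the gap; the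
   cap at 1 gives [tau ^+ 2 <= tau] and a convex combination. *)
pose tau := Num.min 1 ((d ^+ 2 - alpha * d) / (alpha * (C + 1) + D')).
have t0 : 0 < tau by rewrite lt_min ltr01 divr_gt0.
have t1 : tau <= 1 by rewrite ge_min lexx.
have tQ : tau * (alpha * (C + 1) + D') <= d ^+ 2 - alpha * d.
  by rewrite -ler_pdivlMr// ge_min lexx orbT.
(* Raising a negative [s] to [0] stays in the set and decreases the norm. *)
have [z [s [s0 wE wd]]] : exists z s, [/\ 0 <= s,
    epigraphical_set A b (@std_simplex R m) (pair_vec z s) &
    eucl_norm (pair_vec z s) <= d + tau ^+ 2].
  have [_ /epigraphicalP[l [s [lS hs ->]]] wd] := infE _ (exprn_gt0 2 t0).
  exists (A^T *m l), (Num.max 0 s); split; first by rewrite le_max lexx.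
  - apply/epigraphicalP; exists l, (Num.max 0 s); split=> //.
    by rewrite le_max hs orbT.
  - apply: le_trans (ltW wd); apply: ler_eucl_norm.
    rewrite !dotv_pair lerD2l -!expr2.
    by case: (leP 0 s) => // _; rewrite expr0n/= sqr_ge0.
have c0 : 0 < s + tau by rewrite ltr_wpDl.
exists ((s + tau)^-1 *: (tau *: x0 - z)) => i.
set x := _ *: _.
(* Triangle inequality for the splitting of [(s + tau) *: (x, 1)] into [tau *: (x0, 1)] and
   [(- z, s)]. *)
have hN : (s + tau) * eucl_norm (pair_vec x 1) <= tau * C + (d + tau ^+ 2).
  rewrite -eucl_normZ ?(ltW c0)// pair_vecZ mulr1 /x scalerA mulfV ?gt_eqF// scale1r.
  rewrite [s + tau]addrC -[tau in tau + s]mulr1 -pair_vecD -pair_vecZ.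
  apply: (le_trans (ler_eucl_normD _ _)); rewrite eucl_normZ ?(ltW t0)// lerD2l.
  apply: le_trans wd; apply: ler_eucl_norm.
  by rewrite !dotv_pair dotvNl dotvNr opprK.
have : eucl_norm (pair_vec z s) ^+ 2 - tau * D' <=
    dotv (pair_vec z s) (datum A (- b) i).
  apply: near_projection => //; [exact: ltW|by rewrite t0|].
  apply/dE/epigraphical_convex => //; first by rewrite (ltW t0).
  exact: epigraphical_vertex.
have dw : d ^+ 2 <= eucl_norm (pair_vec z s) ^+ 2.
  by rewrite ler_sqr ?nnegrE ?eucl_norm_ge0 ?(ltW d0)// dE.
rewrite dotvC dotv_datum [(- b) i 0]mxE => proj.
rewrite -(ler_pM2l c0) mulr0 mulrDr mulrCA.
have -> : (s + tau) * (A *m x + b) i 0 =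
    tau * (A *m x0 + b) i 0 - ((A *m z) i 0 - b i 0 * s).
  rewrite /x -scalemxAr mulmxBr -scalemxAr !mxE.
  by field; rewrite gt_eqF.
have h1 : tau * (A *m x0 + b) i 0 <= 0 by rewrite mulr_ge0_le0// ltW.
have h2 : alpha * ((s + tau) * eucl_norm (pair_vec x 1)) <=
   alpha * (tau * C + (d + tau ^+ 2)) by rewrite ler_wpM2l.
have h3 : alpha * tau ^+ 2 <= alpha * tau.
  by rewrite ler_wpM2l// expr2 ler_piMr// ltW.
lra.
Qed.

End RobustFeasibility.

Theorem corollary3p1 (R : realType) (m n : nat) (A : 'M[R]_(m, n))
    (b : 'cV[R]_m)
    (hfeas : nominal_feasible (@nonneg_orthant R m) A b !=set0) :
  radius_robust_feasibility (@nonneg_orthant R m) A b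
    = dist_set 0 (epigraphical_set A b (@std_simplex R m)) /\
  dist_set 0 (epigraphical_set A b (@std_simplex R m)) = socp_value A b.
Proof.
set E := epigraphical_set _ _ _.
have dist_le (e : 'cV[R]_(n + 1)) : E e -> (dist_set 0 E <= (eucl_norm e)%:E)%E.
  by move=> eE; apply: ereal_inf_lbound; exists e; rewrite // sub0r eucl_normN.
(* The two comparisons with the conic program come first: a feasible [(z, s)] lies in [E], and a
   point of [E] is feasible with [t] equal to its norm. *)
split; apply/eqP; rewrite eq_le; apply/andP; split; last 2 first.
- apply: le_ereal_inf_tmp => _ [z [s [t [l [[zt zE hs l0 l1] ->]]]]].
  apply: (@le_trans _ _ (eucl_norm (pair_vec z s))%:E); last by rewrite lee_fin.
  by apply/dist_le/epigraphicalP; exists l, s; rewrite zE.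
- apply: le_ereal_inf_tmp => _ [_ /epigraphicalP[l [s [[l0 l1] hs ->]]] <-].
  apply: ereal_inf_lbound; exists (A^T *m l), s, (eucl_norm (pair_vec (A^T *m l) s)), l.
  by split=> //; rewrite sub0r eucl_normN.
- apply: ge_ereal_sup => _ [alpha [a0 [r0 [x /(robust_feasibleP _ _ _ _ r0) hx]]] <-].
  apply: le_ereal_inf_tmp => _ [e eE <-]; rewrite sub0r eucl_normN lee_fin.
  by apply: (radius_le_norm A b alpha x e) => // i; have := hx i; rewrite [const_mx _ _ _]mxE.
have le_radius (alpha : R) : 0 <= alpha -> (exists x, forall i,
    (A *m x + b) i 0 + alpha * eucl_norm (pair_vec x 1) <= 0) ->
    (alpha%:E <= radius_robust_feasibility (@nonneg_orthant R m) A b)%E.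
  move=> a0 [x hx]; apply: ereal_sup_ubound; exists alpha => //; split=> //.
  have r0 : nonneg_orthant (const_mx alpha : 'cV[R]_m) by move=> i; rewrite mxE.
  by split=> //; exists x; apply/robust_feasibleP => // i; rewrite [const_mx _ _ _]mxE.
have [x0 /nominal_feasibleP hx0] := hfeas.
have radius_ge0 : (0%:E <= radius_robust_feasibility (@nonneg_orthant R m) A b)%E.
  by apply: le_radius => //; exists x0 => i; rewrite mul0r addr0.
case dE : (dist_set 0 E) => [d| |]; last by rewrite leNye.
  apply/lee_subgt0Pr => eps eps0; rewrite -EFinB.
  (* Only nonnegative levels can be admissible, so a nonpositive [d - eps] is compared with 0, a
     lower bound of the radius by nominal feasibility. *)
  have [de|de] := leP (d - eps) 0; first by rewrite (le_trans _ radius_ge0) ?lee_fin.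
  apply: le_radius; first exact: ltW.
  apply: (@admissible_lt_dist _ _ _ A b _ d x0 hx0).
  - by rewrite ltW//= ltrBlDr ltrDl.
  - by move=> e /dist_le; rewrite dE lee_fin.
  - move=> dl dl0; have : (dist_set 0 E < (d + dl)%:E)%E.
      by rewrite dE lte_fin ltrDl.
    by move=> /ereal_inf_lt[_ [e eE <-]]; rewrite sub0r eucl_normN lte_fin; exists e.
(* An infinite distance means that [E] has no vertex, hence that there are no rows; every level is
   then vacuously admissible and the radius is infinite too. *)
have noI (i : 'I_m) : False.
  by have := dist_le _ (epigraphical_vertex A b i); rewrite dE leye_eq.
rewrite leye_eq; apply/eqP/eqyP => alpha a0.
by apply: le_radius; [exact: ltW|exists x0 => i; case: (noI i)].
Qed.
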